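(* Let $C$ be a convex body with a center of symmetry in $\mathbb{R}^d$ and let $H_1,\dots,H_n$ be hyperplanes in $\mathbb{R}^d$. Then there is $x\in\mathbb{R}^d$ such that the set $x+\frac{1}{n+1}C$ is contained in $C$ and the interior of $x+\frac{1}{n+1}C$ is not met by any $H_i$. Moreover, the result is sharp for every $n$ and every such $C$: for every $n\ge 1$ and every convex body $C$ in $\mathbb{R}^d$ with a center of symmetry there are hyperplanes $H_1,\dots,H_n$ such that, for every $\lambda>\frac{1}{n+1}$, there is no $x\in\mathbb{R}^d$ for which $x+\lambda C\subset C$ and the interior of $x+\lambda C$ is not met by any $H_i$.
   Context: A convex body in $\mathbb{R}^d$ ($d\ge1$) is a compact convex set with non-empty interior. It has a center of symmetry if there is a point $c$ with $2c-C=C$. Hyperplanes are affine, i.e. of the form $\{x\in\mathbb{R}^d:\phi(x)=m\}$ with $\phi$ a non-zero linear functional and $m\in\mathbb{R}$. *)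

(* Defs.v *)
From HB Require Import structures.
From mathcomp Require Import all_boot all_order all_algebra.
From mathcomp Require Import all_classical all_reals all_analysis.
Import Order.TTheory GRing.Theory Num.Theory.
Import numFieldNormedType.Exports.

Set Implicit Arguments.
Unset Strict Implicit.
Unset Printing Implicit Defensive.

Local Open Scope classical_set_scope.
Local Open Scope ring_scope.

Definition convex_body (R : realType) (d : nat) (C : set 'rV[R]_d) : Prop :=
  [/\ compact C, convex_set C & interior C !=set0].

Definition centrally_symmetric (R : realType) (d : nat) (C : set 'rV[R]_d) :
    Prop :=
  exists c : 'rV[R]_d, [set 2%:R *: c - y | y in C] = C.

Definition hyperplane (R : realType) (d : nat) (H : set 'rV[R]_d) : Prop :=
  exists (phi : {scalar 'rV[R]_d}) (m : R),
    (exists v, phi v != 0) /\ H = [set x | phi x = m].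

Definition scaled_translate (R : realType) (d : nat) (x : 'rV[R]_d) (l : R)
    (C : set 'rV[R]_d) : set 'rV[R]_d :=
  [set x + l *: y | y in C].

(* Main.v *)
Require Import Defs.
From HB Require Import structures.
From mathcomp Require Import all_boot all_order all_algebra.
From mathcomp Require Import all_classical all_reals all_analysis.
From mathcomp Require Import ring lra.
Import Order.TTheory GRing.Theory Num.Theory.
Import numFieldNormedType.Exports.

Local Open Scope classical_set_scope.
Local Open Scope ring_scope.

(** This is Ball's plank theorem for symmetric bodies, in the case of equal
widths. Recentre [C] at [c] to get a symmetric convex [K]. Each hyperplane is
given by a functional [phi i]; let [k i] be a point of [K] where it attains its
maximum [phi i (k i)]. A copy [x + t C] avoids the hyperplane [phi i = m i] in
its interior exactly when [phi i] at its centre is at distance at least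
[t * phi i (k i)] from [m i]. With [t = 1/(n+1)] and the centre taken in
[c + n/(n+1) K], so that the copy lies in [C], everything reduces to
[plank_symmetric]: some [z] in [K] satisfies [|phi i z - m i| >= phi i (k i) / n]
for all [i]. The point [z] is sought as a combination of the [k j] with
coefficients [l j] such that [\sum_j |l j| <= 1], which leaves a question on the
matrix [A i j = phi i (k j) / phi i (k i)], whose diagonal entries are 1
([plank_matrix]).

If [A] is symmetric, Bang's choice of signs answers it with [l j = +- 1/n]
([bang_signs]). In general, one makes [A] symmetric: let [U] maximise
[\prod_i |(A U) i i|] over the orthogonal matrices, and rescale the rows by
[theta i = 1 / (A U) i i]. Comparing [U] with its products by reflections shows
that [H = diag(theta) A U] is symmetric ([diag_extremal_sym]) and positive
semidefinite ([diag_extremal_psd]), and it has unit diagonal. Applying Bang's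
signs to [H] with weights [theta i / n] gives a vector [x], and [l = U x] meets
the distance requirement since the scaling by [theta i] cancels. Positivity of
[H] gives [\sum_i theta i ^ 2 <= n] ([theta_sumsq_le]), so that the Euclidean
norm of [l], equal to that of [x], is at most [1 / sqrt n], whence
[\sum_j |l j| <= 1].

For sharpness, take [n] parallel hyperplanes which cut the width of [C] into
[n+1] equal slabs: a homothetic copy of ratio more than [1/(n+1)] is wider than a
slab, so one of the hyperplanes crosses its interior. *)

Set Implicit Arguments.
Unset Strict Implicit.

(** * Symmetric bilinear forms and their negative eigenvectors *)

Definition bil (R : realType) (n : nat) (H : 'M[R]_n) (x y : 'rV[R]_n) : R :=
  (x *m H *m y^T) ord0 ord0.

Lemma bilDl (R : realType) (n : nat) (H : 'M[R]_n) (x y z : 'rV[R]_n) :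
  bil H (x + y) z = bil H x z + bil H y z.
Proof. by rewrite /bil !mulmxDl [LHS]mxE. Qed.

Lemma bilDr (R : realType) (n : nat) (H : 'M[R]_n) (x y z : 'rV[R]_n) :
  bil H x (y + z) = bil H x y + bil H x z.
Proof. by rewrite /bil linearD mulmxDr [LHS]mxE. Qed.

Lemma bilZl (R : realType) (n : nat) (H : 'M[R]_n) (t : R) (x y : 'rV[R]_n) :
  bil H (t *: x) y = t * bil H x y.
Proof. by rewrite /bil -!scalemxAl [LHS]mxE. Qed.

Lemma bilZr (R : realType) (n : nat) (H : 'M[R]_n) (t : R) (x y : 'rV[R]_n) :
  bil H x (t *: y) = t * bil H x y.
Proof. by rewrite /bil linearZ -scalemxAr [LHS]mxE. Qed.

Lemma bilC (R : realType) (n : nat) (H : 'M[R]_n) (x y : 'rV[R]_n) :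
  H^T = H -> bil H x y = bil H y x.
Proof.
move=> Hs; rewrite /bil -[in LHS](trmxK (x *m H *m y^T)) mxE.
by rewrite !trmx_mul trmxK Hs mulmxA.
Qed.

Lemma bil_line (R : realType) (n : nat) (H : 'M[R]_n) (x y : 'rV[R]_n) (t : R) :
  H^T = H ->
  bil H (x + t *: y) (x + t *: y)
    = bil H x x + 2 * t * bil H x y + t ^+ 2 * bil H y y.
Proof.
by move=> Hs; rewrite bilDl !bilDr !bilZl !bilZr (bilC y x Hs); ring.
Qed.

Lemma bil_delta (R : realType) (n : nat) (H : 'M[R]_n) (x : 'rV[R]_n) (i : 'I_n) :
  bil H x (delta_mx ord0 i) = (x *m H) ord0 i.
Proof. by rewrite /bil trmx_delta -colE mxE. Qed.

Lemma bil_delta_delta (R : realType) (n : nat) (H : 'M[R]_n) (i : 'I_n) :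
  bil H (delta_mx ord0 i) (delta_mx ord0 i) = H i i.
Proof. by rewrite bil_delta -rowE mxE. Qed.

Lemma bil1 (R : realType) (n : nat) (x : 'rV[R]_n) :
  bil 1%:M x x = \sum_k x ord0 k ^+ 2.
Proof. by rewrite /bil mulmx1 mxE; apply: eq_bigr => k _; rewrite mxE expr2. Qed.

Lemma sumsq_eq0 (R : realType) (n : nat) (x : 'rV[R]_n) :
  \sum_k x ord0 k ^+ 2 = 0 -> x = 0.
Proof.
move=> /eqP; rewrite psumr_eq0 => [/allP x0|k _]; last exact: sqr_ge0.
apply/rowP => k; rewrite mxE; apply/eqP.
by have := x0 k (mem_index_enum k); rewrite sqrf_eq0.
Qed.

(** Otherwise moving from [v] against [w = v G] would make the form negative, as
its first-order variation along [w] is [2 |w|^2]. *)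
Lemma psd_isotropic (R : realType) (n : nat) (G : 'M[R]_n) (v : 'rV[R]_n) :
  G^T = G -> (forall x, 0 <= bil G x x) -> bil G v v = 0 -> v *m G = 0.
Proof.
move=> Gs Gp v0; set w := v *m G.
have e : bil G v w = \sum_k w ord0 k ^+ 2 by rewrite -bil1 /bil mulmx1.
have w_ge0 : 0 <= \sum_k w ord0 k ^+ 2 by apply: sumr_ge0 => k _; exact: sqr_ge0.
apply: sumsq_eq0; set N := \sum_k _ in e w_ge0 *.
have q_ge0 := Gp w; set q := bil G w w in q_ge0.
(* the step N / (q + 1) makes the quadratic term smaller than the linear one *)
have := Gp (v + (- (N / (q + 1))) *: w); rewrite bil_line // v0 e -/q.
have -> : 0 + 2 * - (N / (q + 1)) * N + (- (N / (q + 1))) ^+ 2 * q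
   = - (N / (q + 1)) ^+ 2 * (q + 2).
  by field; rewrite gt_eqF // ltr_wpDl.
rewrite mulNr oppr_ge0 pmulr_lle0 ?ltr_wpDl // => le0.
have /eqP : (N / (q + 1)) ^+ 2 = 0 by apply/eqP; rewrite eq_le le0 sqr_ge0.
rewrite sqrf_eq0 mulf_eq0 invr_eq0 [q + 1 == 0]gt_eqF ?ltr_wpDl // orbF.
by move/eqP.
Qed.

Lemma compact_unit_box (R : realType) (n : nat) (A : set 'rV[R]_n) :
  closed A -> (forall v, A v -> forall i, `|v ord0 i| <= 1) -> compact A.
Proof.
move=> Acl A1; apply: (subclosed_compact Acl
  (@rV_compact _ n (fun=> `[(-1 : R), 1]%classic) _)).
  by move=> _; exact: segment_compact.
by move=> v /A1 v1 i /=; rewrite in_itv /= -ler_norml.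
Qed.

Lemma closed_level (R : realType) (T : topologicalType) (f : T -> R) (a : R) :
  continuous f -> closed [set x | f x = a].
Proof.
by move=> /continuous_closedP /(_ [set y | y = a]); apply; exact: closed_eq.
Qed.

Lemma continuous_sum (R : realType) (T : topologicalType) (I : finType)
    (f : I -> T -> R) :
  (forall i, continuous (f i)) -> continuous (fun x => \sum_i f i x).
Proof.
move=> fc x; apply: cvg_big => [|i _]; last exact: fc.
exact: add_continuous.
Qed.

Lemma continuous_mul (R : realType) (T : topologicalType) (f g : T -> R) :
  continuous f -> continuous g -> continuous (fun x => f x * g x).
Proof. by move=> fc gc x; apply: cvgM; [exact: fc | exact: gc]. Qed.

Lemma continuous_prod (R : realType) (T : topologicalType) (I : finType)
    (f : I -> T -> R) :
  (forall i, continuous (f i)) -> continuous (fun x => \prod_i f i x).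
Proof.
move=> fc x; apply: cvg_big => [|i _]; last exact: fc.
exact: mul_continuous.
Qed.

(** Minimise the form on the unit sphere; a minimiser is isotropic for the
positive semidefinite form [H - mu], with [mu] the minimum, hence an eigenvector. *)
Lemma negative_eigenvector (R : realType) (n : nat) (H : 'M[R]_n) (x : 'rV[R]_n) :
  H^T = H -> bil H x x < 0 ->
  exists (mu : R) (v : 'rV[R]_n),
    [/\ mu < 0, \sum_k v ord0 k ^+ 2 = 1 & v *m H = mu *: v].
Proof.
move=> Hs xneg; pose S := [set v : 'rV[R]_n | \sum_k v ord0 k ^+ 2 = 1].
have normalize (y : 'rV[R]_n) : y != 0 ->
    exists2 r : R, 0 < r & S (r *: y).
  move=> y0; set N := \sum_k y ord0 k ^+ 2.
  have N_gt0 : 0 < N.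
    rewrite lt0r sumr_ge0 ?andbT => [|k _]; last exact: sqr_ge0.
    by apply: contra_neq y0; exact: sumsq_eq0.
  exists (Num.sqrt N)^-1; first by rewrite invr_gt0 sqrtr_gt0.
  rewrite /S /= -bil1 bilZl bilZr bil1 -/N mulrA -expr2 exprVn sqr_sqrtr ?ltW // mulVf //.
  by rewrite gt_eqF.
have x0 : x != 0.
  by apply: contraTneq xneg => ->; rewrite /bil !mul0mx mxE ltxx.
have Scompact : compact S.
  apply: compact_unit_box => [|v Sv i].
    apply: closed_level; apply: continuous_sum => i.
    rewrite (_ : (fun _ => _) = fun y : 'rV[R]_n => y ord0 i * y ord0 i).
      by apply: continuous_mul; exact: coord_continuous.
    by apply/funext => y; rewrite expr2.
  rewrite -(@ler_pXn2r _ 2) ?nnegrE // expr1n -normrX ger0_norm ?sqr_ge0 //.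
  rewrite -Sv (bigD1 i) //= lerDl; apply: sumr_ge0 => k _; exact: sqr_ge0.
have [||v /set_mem Sv vmin] := @compact_EVT_min _ _ (fun v => bil H v v) S _ Scompact.
- by have [r _ Sr] := normalize x x0; exists (r *: x).
- apply: continuous_subspaceT.
  rewrite (_ : (fun _ => _) = fun v : 'rV[R]_n =>
      \sum_k (\sum_j v ord0 j * H j k) * v ord0 k); last first.
    apply/funext => v; rewrite /bil mxE; apply: eq_bigr => k _.
    by rewrite !mxE.
  apply: continuous_sum => k; apply: continuous_mul; last exact: coord_continuous.
  apply: continuous_sum => j; apply: continuous_mul; first exact: coord_continuous.
  exact: cst_continuous.
set mu := bil H v v in vmin.
have muP y : mu * bil 1%:M y y <= bil H y y.
  have [->|y0] := eqVneq y 0; first by rewrite /bil !mul0mx !mxE mulr0.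
  have [r r_gt0 Sr] := normalize y y0.
  have := vmin _ (mem_set Sr).
  move: Sr; rewrite /S /= -bil1 !(bilZl, bilZr) => Sr vmin_y.
  rewrite -(@ler_pM2l _ (r * r)) ?mulr_gt0 //.
  rewrite (_ : r * r * _ = mu * (r * (r * bil 1%:M y y))); last by ring.
  by rewrite Sr mulr1 -mulrA.
have bilG y : bil (H - mu%:M) y y = bil H y y - mu * bil 1%:M y y.
  rewrite /bil mulmxBr mulmxBl mul_mx_scalar mulmx1 -scalemxAl.
  by rewrite [LHS]mxE [X in _ + X]mxE [X in _ - X]mxE.
exists mu, v; split => //.
- apply: contraTlt xneg; rewrite -!leNgt => mu_ge0.
  apply: le_trans (muP x); rewrite bil1 mulr_ge0 //.
  by apply: sumr_ge0 => k _; exact: sqr_ge0.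
- apply/eqP; rewrite -subr_eq0 -mul_mx_scalar -mulmxBr; apply/eqP.
  apply: psd_isotropic => [|y|].
  + by rewrite linearB /= tr_scalar_mx Hs.
  + by rewrite bilG subr_ge0.
  + by rewrite bilG bil1 Sv mulr1 subrr.
Qed.

(** * Matrices with an extremal product of diagonal entries *)

Definition orthogonal_mx (R : realType) (n : nat) (U : 'M[R]_n) : Prop :=
  U *m U^T = 1%:M.

Lemma orthogonal_mulmx (R : realType) (n : nat) (U W : 'M[R]_n) :
  orthogonal_mx U -> orthogonal_mx W -> orthogonal_mx (U *m W).
Proof.
move=> Uo Wo; rewrite /orthogonal_mx trmx_mul mulmxA -(mulmxA U) Wo mulmx1.
exact: Uo.
Qed.

Lemma reflection_orthogonal (R : realType) (n : nat) (v : 'rV[R]_n) :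
  v != 0 ->
  orthogonal_mx (1%:M - (2 / \sum_k v ord0 k ^+ 2) *: (v^T *m v)).
Proof.
move=> v0; set N := \sum_k _.
have N0 : N != 0 by apply: contra_neq v0; exact: sumsq_eq0.
have vv : v *m v^T = N%:M.
  rewrite [LHS]mx11_scalar; congr (_%:M).
  by rewrite /N -bil1 /bil mulmx1.
set c := 2 / N; rewrite /orthogonal_mx.
have -> : (1%:M - c *: (v^T *m v))^T = 1%:M - c *: (v^T *m v).
  by apply/matrixP => i j; rewrite !mxE !big_ord1 !mxE eq_sym [v _ _ * _]mulrC.
rewrite mulmxBl mul1mx mulmxBr mulmx1 -scalemxAl -scalemxAr mulmxA.
rewrite -(mulmxA v^T v v^T) vv mul_mx_scalar -scalemxAl !scalerA.
rewrite (_ : c * (c * N) = c + c); last by rewrite /c; field.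
by rewrite scalerDl opprB addrK subrK.
Qed.

Lemma reflection_diag (R : realType) (n : nat) (H : 'M[R]_n) (v : 'rV[R]_n)
    (c : R) (i : 'I_n) :
  (H *m (1%:M - c *: (v^T *m v))) i i
    = H i i - c * (v *m H^T) ord0 i * v ord0 i.
Proof.
rewrite mulmxBr mulmx1 -scalemxAr mulmxA [LHS]mxE; congr (_ + _).
rewrite [LHS]mxE [X in - X]mxE [X in _ * X]mxE big_ord1 mulrA; congr (- (_ * _ * _)).
  by rewrite -[v *m H^T]trmxK trmx_mul trmxK [RHS]mxE.
Qed.

(** [H] normalises [A U] for an orthogonal [U] that maximises the product of the
absolute diagonal entries, so that the identity is the best right factor for [H]. *)
Definition diag_extremal (R : realType) (n : nat) (H : 'M[R]_n) : Prop :=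
  (forall i, H i i = 1) /\
  forall W, orthogonal_mx W -> \prod_i `|(H *m W) i i| <= 1.

Lemma diag_extremal_reflection (R : realType) (n : nat) (H : 'M[R]_n)
    (v : 'rV[R]_n) :
  diag_extremal H -> v != 0 ->
  \prod_i `|1 - 2 / (\sum_k v ord0 k ^+ 2) * (v *m H^T) ord0 i * v ord0 i| <= 1.
Proof.
move=> [H1 Hmax] v0; have := Hmax _ (reflection_orthogonal v0).
by under eq_bigr do rewrite reflection_diag H1.
Qed.

(** At [t = 0] both sides are 1, and the derivative of the left-hand product there
is [2 (a - b)]. *)
Lemma le_of_reflection_bound (R : realType) (a b : R) :
  (forall t : R, `|(1 - t ^+ 2 + 2 * a * t) * (1 - t ^+ 2 - 2 * b * t)|
                   <= (1 + t ^+ 2) ^+ 2) -> a <= b.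
Proof.
move=> ab; rewrite leNgt; apply/negP => ba.
pose D := 1 + `|a * b|; have D_ge1 : 1 <= D by rewrite lerDl.
have abD : 1 + a * b <= D by rewrite lerD2l ler_norm.
(* t is small enough for 2 t D to be beaten by (1 - t^2) (a - b) *)
pose t := (a - b) / (4 * (D + (a - b))).
have ba0 : 0 < a - b by rewrite subr_gt0.
have den_gt0 : 0 < 4 * (D + (a - b)) by lra.
have t_gt0 : 0 < t by rewrite mulr_gt0 // invr_gt0.
have tE : t * (4 * (D + (a - b))) = a - b by rewrite mulfVK // gt_eqF.
have := ab t; rewrite ler_norml => /andP[_].
have -> : (1 - t ^+ 2 + 2 * a * t) * (1 - t ^+ 2 - 2 * b * t)
  = (1 + t ^+ 2) ^+ 2 + 2 * t * ((1 - t ^+ 2) * (a - b) - 2 * t * (1 + a * b)).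
  by ring.
have t2_gt0 : 0 < 2 * t by rewrite mulr_gt0.
rewrite gerDl pmulr_rle0 // => h.
have t4 : t <= 4^-1 by rewrite ler_pdivrMr //; lra.
have t2 : t ^+ 2 <= 4^-1 by rewrite expr2; nra.
have h1 : t * (1 + a * b) <= t * D by rewrite ler_pM2l.
have h2 : t * (a - b) > 0 by rewrite mulr_gt0.
have h3 : t ^+ 2 * (a - b) <= 4^-1 * (a - b) by rewrite ler_pM2r.
nra.
Qed.

(** For [i != j], reflect along [e_i + t e_j]: only the diagonal entries [i] and [j]
change, and stationarity at [t = 0] forces [H i j = H j i]. *)
Lemma diag_extremal_sym (R : realType) (n : nat) (H : 'M[R]_n) :
  diag_extremal H -> H^T = H.
Proof.
move=> He; suff le_sym i j : i != j -> H i j <= H j i.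
  apply/matrixP => i j; rewrite mxE; have [->//|ij] := eqVneq i j.
  by apply/eqP; rewrite eq_le !le_sym // eq_sym.
move=> ij; have ji : j != i by rewrite eq_sym.
apply: le_of_reflection_bound => t.
pose v : 'rV[R]_n := delta_mx ord0 i + t *: delta_mx ord0 j.
have vE k : v ord0 k = (k == i)%:R + t * (k == j)%:R by rewrite !mxE.
have v0 : v != 0.
  apply/eqP => /rowP /(_ i); rewrite vE mxE eqxx (negbTE ij) mulr0 addr0.
  by apply/eqP; exact: oner_neq0.
have vN : \sum_k v ord0 k ^+ 2 = 1 + t ^+ 2.
  rewrite (bigD1 i) // (bigD1 j) //= !vE !eqxx (negbTE ij) (negbTE ji).
  rewrite mulr0 addr0 add0r mulr1 expr1n big1 ?addr0 // => k /andP[ki kj].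
  by rewrite vE (negbTE ki) (negbTE kj) mulr0 addr0 expr0n.
have vH k : (v *m H^T) ord0 k = H k i + t * H k j.
  by rewrite mulmxDl -scalemxAl -!rowE !mxE.
have [H1 _] := He; have := diag_extremal_reflection He v0; rewrite vN.
rewrite (bigD1 i) // (bigD1 j) //= big1 ?mulr1 => [|k /andP[ki kj]]; last first.
  by rewrite vE (negbTE ki) (negbTE kj) mulr0 addr0 mulr0 subr0 normr1.
rewrite !vH !vE !eqxx (negbTE ij) (negbTE ji) !H1 -normrM /= !mulr1n !mulr0n.
have N_gt0 : 0 < 1 + t ^+ 2 by rewrite ltr_pwDl // sqr_ge0.
set x := _ * _; set y := (X in _ -> X <= _).
have -> : x = - ((1 - t ^+ 2 + 2 * H i j * t) * (1 - t ^+ 2 - 2 * H j i * t))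
              / (1 + t ^+ 2) ^+ 2.
  by rewrite /x; field; rewrite gt_eqF.
rewrite normf_div normrN [X in _ / X]ger0_norm ?sqr_ge0 //.
by rewrite ler_pdivrMr ?exprn_gt0 // mul1r.
Qed.

(** Reflecting along a unit eigenvector [v] of eigenvalue [mu < 0] would turn
the diagonal entries into [1 - 2 mu (v i)^2 >= 1], not all equal to 1. *)
Lemma diag_extremal_psd (R : realType) (n : nat) (H : 'M[R]_n) (x : 'rV[R]_n) :
  diag_extremal H -> 0 <= bil H x x.
Proof.
move=> He; have Hs := diag_extremal_sym He; rewrite leNgt; apply/negP => xneg.
have [mu [v [mu_lt0 v1 vH]]] := negative_eigenvector Hs xneg.
have v0 : v != 0.
  apply/eqP => v0; move: v1; rewrite v0 big1 => [/esym/eqP|k _].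
    by rewrite oner_eq0.
  by rewrite mxE expr0n.
have := diag_extremal_reflection He v0; rewrite leNgt => /negP; apply.
have factorE i : 1 - 2 / (\sum_k v ord0 k ^+ 2) * (v *m H^T) ord0 i * v ord0 i
    = 1 + (- mu * 2) * v ord0 i ^+ 2.
  by rewrite v1 Hs vH mxE; field.
have c_gt0 : 0 < - mu * 2 by rewrite mulr_gt0 // oppr_gt0.
have factor_ge1 i : 1 <= `|1 + (- mu * 2) * v ord0 i ^+ 2|.
  have p_ge0 : 0 <= - mu * 2 * v ord0 i ^+ 2 by rewrite mulr_ge0 ?sqr_ge0 // ltW.
  by rewrite ger0_norm ?lerDl // addr_ge0.
under eq_bigr do rewrite factorE.
have [i vi0] : exists i, v ord0 i != 0.
  apply/existsP; apply: contraNT v0 => /existsPn vi; apply/eqP/rowP => i.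
  by rewrite mxE; apply/eqP; rewrite -[_ == _]negbK vi.
rewrite (bigD1 i) //=.
have gt1 : 1 < `|1 + (- mu * 2) * v ord0 i ^+ 2|.
  have p_gt0 : 0 < - mu * 2 * v ord0 i ^+ 2.
    by rewrite mulr_gt0 // lt0r sqr_ge0 sqrf_eq0 vi0.
  by rewrite gtr0_norm ?ltrDl // addr_gt0.
apply: (lt_le_trans gt1); rewrite ler_peMr //.
elim/big_ind: _ => // a b a1 b1; exact: mulr_ege1.
Qed.

(** * The plank problem for matrices *)

Lemma orthogonal_sumsq (R : realType) (n : nat) (U : 'M[R]_n) (s : 'cV[R]_n) :
  orthogonal_mx U ->
  \sum_i (U *m s) i ord0 ^+ 2 = \sum_i s i ord0 ^+ 2.
Proof.
move=> Uo; have sq (z : 'cV[R]_n) : \sum_i z i ord0 ^+ 2 = (z^T *m z) ord0 ord0.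
  by rewrite mxE; apply: eq_bigr => i _; rewrite mxE expr2.
by rewrite !sq trmx_mul mulmxA -(mulmxA s^T) (mulmx1C Uo) mulmx1.
Qed.

Lemma orthogonal_entry_le1 (R : realType) (n : nat) (U : 'M[R]_n) (i j : 'I_n) :
  orthogonal_mx U -> `|U i j| <= 1.
Proof.
move=> /matrixP /(_ i i); rewrite !mxE eqxx => Ui.
rewrite -(@ler_pXn2r _ 2) ?nnegrE // expr1n -normrX ger0_norm ?sqr_ge0 //.
rewrite -[leRHS]/(true%:R) -Ui (bigD1 j) //= mxE -expr2 lerDl.
by apply: sumr_ge0 => k _; rewrite mxE -expr2 sqr_ge0.
Qed.

(** The orthogonal group is compact. *)
Lemma orthogonal_diag_max (R : realType) (n : nat) (A : 'M[R]_n) :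
  exists2 U, orthogonal_mx U &
    forall W, orthogonal_mx W ->
      \prod_i `|(A *m W) i i| <= \prod_i `|(A *m U) i i|.
Proof.
pose O := [set u : 'rV[R]_(n * n) | orthogonal_mx (vec_mx u)].
have O_neq0 : O !=set0.
  by exists (mxvec 1%:M); rewrite /O /= mxvecK /orthogonal_mx trmx1 mulmx1.
have entry_continuous i j : continuous (fun u : 'rV[R]_(n * n) => vec_mx u i j).
  rewrite (_ : (fun _ => _) = fun u : 'rV_(n * n) => u ord0 (mxvec_index i j)).
    exact: coord_continuous.
  by apply/funext => u; rewrite mxE.
have O_compact : compact O.
  apply: compact_unit_box => [|v Ov k]; last first.
    by case/mxvec_indexP: k => i j; rewrite -[v]vec_mxK mxvecE orthogonal_entry_le1.
  rewrite (_ : O = \bigcap_(p in [set: 'I_n * 'I_n]) [set u : 'rV[R]_(n * n) |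
      \sum_k vec_mx u p.1 k * vec_mx u p.2 k = (p.1 == p.2)%:R]); last first.
    apply/seteqP; split=> [u /matrixP Ou [i j] _ /=|u Ou].
      have := Ou i j; rewrite !mxE => <-; apply: eq_bigr => k _.
      by congr (_ * _); rewrite [RHS]mxE.
    apply/matrixP => i j; rewrite !mxE -(Ou (i, j) I) /=.
    by apply: eq_bigr => k _; congr (_ * _); rewrite [LHS]mxE.
  apply: closed_bigI => -[i j] _; apply: closed_level.
  by apply: continuous_sum => k; apply: continuous_mul; exact: entry_continuous.
have [||u /set_mem Ou umax] :=
    @compact_EVT_max _ _ (fun u => \prod_i `|(A *m vec_mx u) i i|) O _ O_compact.
- exact: O_neq0.
- apply: continuous_subspaceT; apply: continuous_prod => i.
  have diag_continuous : continuous (fun u : 'rV[R]_(n * n) => (A *m vec_mx u) i i).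
    rewrite (_ : (fun _ => _) = fun u => \sum_k A i k * vec_mx u k i); last first.
      by apply/funext => u; rewrite mxE.
    apply: continuous_sum => k; apply: continuous_mul; last exact: entry_continuous.
    exact: cst_continuous.
  by move=> u; apply: (continuous_comp (diag_continuous u)); exact: norm_continuous.
exists (vec_mx u) => // W Wo; rewrite -[W in X in X <= _]mxvecK.
by apply: umax; apply/mem_set; rewrite /O /= mxvecK.
Qed.

(** The maximal product is nonzero because the identity matrix already gives 1. *)
Lemma diag_extremal_factor (R : realType) (n : nat) (A : 'M[R]_n) :
  (forall i, A i i = 1) ->
  exists (U : 'M[R]_n) (theta : 'rV[R]_n),
    [/\ orthogonal_mx U, forall i, theta ord0 i != 0 &
        diag_extremal (diag_mx theta *m A *m U)].
Proof.
move=> A1; have [U Uo Umax] := orthogonal_diag_max A.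
have diag_neq0 i : (A *m U) i i != 0.
  have : 1 <= \prod_i `|(A *m U) i i|.
    have := Umax 1%:M; rewrite /orthogonal_mx trmx1 mulmx1 => /(_ erefl).
    by rewrite big1 // => k _; rewrite mulmx1 A1 normr1.
  apply: contraTneq => Ui0; rewrite (bigD1 i) //= Ui0 normr0 mul0r.
  by rewrite -ltNge ltr01.
exists U, (\row_i ((A *m U) i i)^-1); split=> [//|i|].
  by rewrite mxE invr_neq0.
have scaled W i : (diag_mx (\row_i ((A *m U) i i)^-1) *m A *m W) i i
    = ((A *m U) i i)^-1 * (A *m W) i i.
  by rewrite -mulmxA mul_diag_mx !mxE.
split=> [i|W Wo]; first by rewrite scaled mulVf.
rewrite -(mulmxA _ U W).
under eq_bigr do rewrite scaled normrM normfV.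
rewrite big_split /= prodfV mulrC ler_pdivrMr.
  by rewrite mul1r; apply: Umax; exact: orthogonal_mulmx.
by apply: prodr_gt0 => i _; rewrite normr_gt0.
Qed.

(** As [H U^T = diag(theta) A] has diagonal [theta], positivity of [H] at
[row i U - theta i e_i] gives [theta i ^ 2 <= (U H U^T) i i]. The trace of
[U H U^T] is that of [H], namely [n]. *)
Lemma theta_sumsq_le (R : realType) (n : nat) (A U : 'M[R]_n) (theta : 'rV[R]_n) :
  (forall i, A i i = 1) -> orthogonal_mx U ->
  diag_extremal (diag_mx theta *m A *m U) ->
  \sum_i theta ord0 i ^+ 2 <= n%:R.
Proof.
move=> A1 Uo; set H := _ *m _ *m _ => He.
have Hs := diag_extremal_sym He.
have HU : H *m U^T = diag_mx theta *m A by rewrite -mulmxA Uo mulmx1.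
have thetaE i : bil H (delta_mx ord0 i) (row i U) = theta ord0 i.
  rewrite /bil -mulmxA tr_row mulmxA -[delta_mx _ _ *m H]rowE.
  rewrite colE mulmxA -row_mul HU -colE mxE mxE mul_diag_mx mxE A1 mulr1 //.
have theta_le i : theta ord0 i ^+ 2 <= bil H (row i U) (row i U).
  have := diag_extremal_psd (row i U + (- theta ord0 i) *: delta_mx ord0 i) He.
  rewrite bil_line // bil_delta_delta (bilC _ _ Hs) thetaE (He.1 i).
  by nra.
apply: le_trans (ler_sum _ (fun i _ => theta_le i)) _.
have -> : \sum_i bil H (row i U) (row i U) = \tr (U *m H *m U^T).
  by apply: eq_bigr => i _; rewrite /bil tr_row colE mulmxA -!row_mul -colE mxE mxE.
rewrite mxtrace_mulC mulmxA (mulmx1C Uo) mul1mx /mxtrace.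
by under eq_bigr do rewrite He.1; rewrite sumr_const card_ord.
Qed.

(** Among the sign patterns [x i = +- s i], take one that maximises
[x H x^T - 2 x m^T]. Flipping the sign of [x i] does not increase this quantity,
which says that [x i * ((x H) i - m i) >= (s i)^2]. *)
Lemma bang_signs (R : realType) (n : nat) (H : 'M[R]_n) (s m : 'rV[R]_n) :
  H^T = H -> (forall i, H i i = 1) ->
  exists x : 'rV[R]_n,
    (forall i, x ord0 i ^+ 2 = s ord0 i ^+ 2) /\
    (forall i, `|s ord0 i| <= `|(x *m H) ord0 i - m ord0 i|).
Proof.
move=> Hs H1.
pose vec (e : {ffun 'I_n -> bool}) : 'rV[R]_n :=
  \row_i ((-1) ^+ e i * s ord0 i).
pose F e := bil H (vec e) (vec e) - 2 * bil 1%:M (vec e) m.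
have [e eP] : exists e, forall e', F e' <= F e.
  by case: (@arg_maxP _ _ _ [ffun=> false] xpredT F erefl) => e _ eP;
    exists e => ?; exact: eP.
have vec_sq i : vec e ord0 i ^+ 2 = s ord0 i ^+ 2.
  by rewrite mxE exprMn sqrr_sign mul1r.
exists (vec e); split=> // i; set x := vec e in vec_sq *.
(* e' differs from e in the sign at i *)
pose e' := [ffun k => (k == i) (+) e k].
have xE k : x ord0 k = (-1) ^+ e k * s ord0 k by rewrite mxE.
have flip : vec e' = x + (- 2 * x ord0 i) *: delta_mx ord0 i.
  apply/rowP => k; rewrite [RHS]mxE [X in _ + X]mxE [X in _ * X]mxE eqxx /=.
  rewrite mxE ffunE; have [->|_] := eqVneq k i.
    rewrite addTb signrN mulNr -xE mulr1 -[RHS]/(x ord0 i + - 2 * x ord0 i).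
    by ring.
  by rewrite addFb -xE mulr0 addr0.
have bil1m k : bil 1%:M (delta_mx ord0 k) m = m ord0 k.
  by rewrite bilC ?trmx1 // bil_delta mulmx1.
have := eP e'; rewrite /F flip bil_line // bil_delta bil_delta_delta H1.
rewrite bilDl bilZl bil1m -/x; set y := (x *m H) ord0 i.
move=> h; have {h} : s ord0 i ^+ 2 <= x ord0 i * (y - m ord0 i).
  by rewrite -vec_sq; nra.
have -> : `|s ord0 i| = `|x ord0 i| by rewrite -!sqrtr_sqr vec_sq.
rewrite -vec_sq -real_normK ?num_real // => h.
have [->|xi0] := eqVneq (x ord0 i) 0; first by rewrite normr0.
rewrite -(@ler_pM2l _ `|x ord0 i|) ?normr_gt0 // -expr2 -normrM.
exact: le_trans (ler_norm _).
Qed.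

Lemma plank_matrix (R : realType) (n : nat) (A : 'M[R]_n) (m : 'I_n -> R) :
  (0 < n)%N -> (forall i, A i i = 1) ->
  exists l : 'I_n -> R,
    \sum_j `|l j| <= 1 /\
    forall i, n%:R^-1 <= `|\sum_j A i j * l j - m i|.
Proof.
move=> n_gt0 A1; have [U [theta [Uo theta0 He]]] := diag_extremal_factor A1.
set H := _ *m _ *m U in He.
have nR : 0 < n%:R :> R by rewrite ltr0n.
have [H1 _] := He; have Hs := diag_extremal_sym He.
have [x [xsq xbang]] :=
  bang_signs (n%:R^-1 *: theta) (\row_i (theta ord0 i * m i)) Hs H1.
exists (fun j => (U *m x^T) j ord0); split.
  have sumsq : n%:R * \sum_j (U *m x^T) j ord0 ^+ 2 <= 1.
    rewrite orthogonal_sumsq //.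
    under eq_bigr do rewrite mxE xsq mxE exprMn.
    rewrite -mulr_sumr mulrA exprVn expr2 invfM mulrA mulfV ?gt_eqF // mul1r.
    by rewrite mulrC ler_pdivrMr // mul1r (theta_sumsq_le A1 Uo He).
  (* arithmetic-geometric means, with equality when |l j| = 1 / n *)
  have amgm j : `|(U *m x^T) j ord0|
      <= 2^-1 * (n%:R * (U *m x^T) j ord0 ^+ 2) + 2^-1 * n%:R^-1.
    rewrite -[_ ^+ 2]real_normK ?num_real //; set z := `|_|.
    rewrite -subr_ge0 (_ : _ - z = 2^-1 * n%:R^-1 * (n%:R * z - 1) ^+ 2).
      by rewrite mulr_ge0 ?sqr_ge0 // mulr_ge0 // invr_ge0 ltW.
    by field; rewrite gt_eqF.
  apply: le_trans (ler_sum _ (fun j _ => amgm j)) _.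
  rewrite big_split /= -!mulr_sumr sumr_const card_ord -[_^-1 *+ n]mulr_natr.
  by rewrite mulVf ?gt_eqF //; lra.
move=> i; rewrite -(@ler_pM2l _ `|theta ord0 i|) ?normr_gt0 // -normrM mulrBr.
have xH : (x *m H) ord0 i = theta ord0 i * \sum_j A i j * (U *m x^T) j ord0.
  rewrite -[x *m _]trmxK trmx_mul Hs mxE /H -2!mulmxA mul_diag_mx mxE.
  by rewrite -mulmxA [X in _ * X = _]mxE.
have := xbang i; rewrite xH [X in _ - X]mxE; congr (_ <= _).
by rewrite mxE normrM normfV normr_nat mulrC.
Qed.

(** * Symmetric convex sets and support points *)

Definition symmetric_convex (R : realType) (V : lmodType R) (K : set V) : Prop :=
  (forall k, K k -> K (- k)) /\
  (forall k h t, 0 <= t -> t <= 1 -> K k -> K h -> K (t *: k + (1 - t) *: h)).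

Lemma convex_set_segment (R : realType) (V : lmodType R) (C : set V) (x y : V)
    (t : R) :
  convex_set C -> C x -> C y -> 0 <= t -> t <= 1 -> C (t *: x + (1 - t) *: y).
Proof.
move=> Cc Cx Cy t0 t1; apply: set_mem.
exact: (Cc x y (Itv01 t0 t1) (mem_set Cx) (mem_set Cy)).
Qed.

Lemma recentered_symmetric_convex (R : realType) (d : nat) (C : set 'rV[R]_d)
    (c : 'rV[R]_d) :
  convex_set C -> [set 2%:R *: c - y | y in C] = C ->
  symmetric_convex [set k | C (c + k)].
Proof.
move=> Cc Csym; split=> [k Ck|k h t t0 t1 Ck Ch] /=.
  rewrite -Csym; exists (c + k) => //.
  by rewrite scaler_nat mulr2n opprD addrA addrK.
rewrite (_ : c + _ = t *: (c + k) + (1 - t) *: (c + h)).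
  exact: convex_set_segment.
by rewrite !scalerDr addrACA -scalerDl [t + _]addrC subrK scale1r.
Qed.

Lemma symmetric_convex0 (R : realType) (V : lmodType R) (K : set V) (k : V) :
  symmetric_convex K -> K k -> K 0.
Proof.
move=> [Kn Kc] Kk; have := Kc k (- k) 2^-1 _ _ Kk (Kn _ Kk).
rewrite (_ : 1 - 2^-1 = 2^-1 :> R); last by field.
by rewrite scalerN subrr; apply; lra.
Qed.

Lemma symmetric_convexZ (R : realType) (V : lmodType R) (K : set V) (k : V) (r : R) :
  symmetric_convex K -> K k -> `|r| <= 1 -> K (r *: k).
Proof.
move=> Ks Kk r1; have K0 := symmetric_convex0 Ks Kk.
suff pos (h : V) : K h -> K (`|r| *: h).
  have [r0|r0] := leP 0 r; first by rewrite -[r]ger0_norm //; exact: pos.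
  rewrite (_ : r *: k = `|r| *: - k); first exact/pos/Ks.1.
  by rewrite ltr0_norm // scalerN scaleNr opprK.
move=> Kh; have := Ks.2 _ _ _ (normr_ge0 r) r1 Kh K0.
by rewrite scaler0 addr0.
Qed.

Lemma symmetric_convex_sum (R : realType) (V : lmodType R) (K : set V)
    (I : finType) (l : I -> R) (k : I -> V) (k0 : V) :
  symmetric_convex K -> K k0 -> (forall i, K (k i)) -> \sum_i `|l i| <= 1 ->
  K (\sum_i l i *: k i).
Proof.
move=> Ks Kk0 Kk l1; have K0 := symmetric_convex0 Ks Kk0.
(* the partial sums stay in the dilate of K by the partial sum of the |l i| *)
pose P (r : R) (v : V) := 0 <= r /\ exists2 h, K h & v = r *: h.
have [_ [h Kh ->]] : P (\sum_i `|l i|) (\sum_i l i *: k i).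
  elim/big_ind2: _ => [|v r w s [r0 [h Kh ->]] [s0 [g Kg ->]]|i _].
  - by split=> //; exists 0; rewrite ?scaler0.
  - split; first exact: addr_ge0.
    have [rs0|rs0] := eqVneq (r + s) 0.
      have [z_r z_s] : r = 0 /\ s = 0 by split; lra.
      by exists 0 => //; rewrite z_r z_s !scale0r !addr0 scaler0.
    have rs_gt0 : 0 < r + s by rewrite lt0r rs0 addr_ge0.
    exists (r / (r + s) *: h + (1 - r / (r + s)) *: g).
      apply: Ks.2 => //; first by rewrite divr_ge0 // ltW.
      by rewrite ler_pdivrMr // mul1r lerDl.
    rewrite scalerDr !scalerA; congr (_ *: _ + _ *: _); by field.
  - split=> //; exists (Num.sg (l i) *: k i); last by rewrite scalerA mulrC -numEsg.
    apply: symmetric_convexZ => //; rewrite normr_sg.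
    by case: (_ == _); rewrite ?ler01.
by apply: symmetric_convexZ => //; rewrite ger0_norm // sumr_ge0.
Qed.

Lemma exists_small_scale (R : realType) (V : normedModType R) (v : V) (e : R) :
  0 < e -> exists2 s : R, 0 < s & `|s *: v| < e.
Proof.
move=> e_gt0; have v_gt0 : 0 < `|v| + 1 by rewrite ltr_wpDl.
exists (e / (`|v| + 1)); first by rewrite divr_gt0.
rewrite normrZ ger0_norm ?divr_ge0 ?ltW // mulrAC ltr_pdivrMr //.
by rewrite ltr_pM2l // ltrDl.
Qed.

Lemma interior_normP (R : realType) (V : normedModType R) (A : set V) (p : V) :
  A° p <-> exists2 e : R, 0 < e & forall u, `|u| < e -> A (p + u).
Proof.
rewrite /interior /= nbhs_ballP; split=> -[e e_gt0 eA]; exists e => //=.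
- by move=> u ue; apply: eA; rewrite -ball_normE /ball_ /= opprD addNKr normrN.
- move=> z; rewrite -ball_normE /ball_ /= distrC => zp.
  by rewrite -[z](subrK p) addrC; exact: eA.
Qed.

(** The centre is the midpoint of an interior point and its mirror image. *)
Lemma recentered_ball (R : realType) (d : nat) (C : set 'rV[R]_d) (c : 'rV[R]_d) :
  symmetric_convex [set k | C (c + k)] -> C° !=set0 ->
  exists2 e : R, 0 < e & forall u, `|u| < e -> C (c + u).
Proof.
move=> Ks [p /interior_normP[e e_gt0 pC]]; exists (e / 2) => [|u ue].
  by rewrite divr_gt0.
have Kp : C (c + (p - c)).
  by rewrite addrC subrK -[p]addr0; apply: pC; rewrite normr0.
(* u is the midpoint of p - c + 2 u and of - (p - c) *)
have Kpu : C (c + (p - c + 2 *: u)).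
  rewrite addrA [c + _]addrC subrK; apply: pC.
  by rewrite normrZ gtr0_norm // mulrC -ltr_pdivlMr.
have := Ks.2 _ _ 2^-1 _ _ Kpu (Ks.1 _ Kp); rewrite /=.
rewrite (_ : 1 - 2^-1 = 2^-1 :> R); last by field.
rewrite -scalerDr addrAC subrr add0r scalerA mulVf // scale1r.
by apply; lra.
Qed.

Lemma continuous_scalar (R : realType) (d : nat) (phi : {scalar 'rV[R]_d}) :
  continuous (phi : 'rV[R]_d -> R).
Proof.
rewrite (_ : (phi : _ -> _) = fun x => \sum_j x ord0 j * phi (delta_mx ord0 j)).
  apply: continuous_sum => j; apply: continuous_mul; last exact: cst_continuous.
  exact: coord_continuous.
apply/funext => x; rewrite [in LHS](row_sum_delta x) linear_sum.
by apply: eq_bigr => j _; rewrite linearZ.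
Qed.

Definition support_point (R : realType) (V : lmodType R) (K : set V)
    (phi : V -> R) (k : V) : Prop :=
  [/\ K k, 0 < phi k & forall h, K h -> `|phi h| <= phi k].

Lemma support_point_exists (R : realType) (d : nat) (C : set 'rV[R]_d)
    (c : 'rV[R]_d) (phi : {scalar 'rV[R]_d}) :
  compact C -> symmetric_convex [set k | C (c + k)] -> C° !=set0 ->
  (exists v, phi v != 0) ->
  exists k, support_point [set k | C (c + k)] phi k.
Proof.
move=> Ccp Ks Cint [v phiv0].
have [e e_gt0 cC] := recentered_ball Ks Cint.
have [||x /set_mem Cx xmax] := @compact_EVT_max _ _ (phi : _ -> R) C _ Ccp.
- by exists (c + 0); apply: cC; rewrite normr0.
- by apply: continuous_subspaceT; exact: continuous_scalar.
have phi_le h : C (c + h) -> `|phi h| <= phi (x - c).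
  move=> Ch; rewrite linearB ler_norml lerBrDr lerNl lerBrDr.
  rewrite -!linearN -!linearD ![_ + c]addrC.
  by apply/andP; split; apply/xmax/mem_set => //; exact: Ks.1.
exists (x - c); split=> //; first by rewrite /= addrC subrK.
have [s s_gt0 sv] := exists_small_scale v e_gt0.
apply: lt_le_trans (phi_le _ (cC _ sv)).
by rewrite normr_gt0 linearZ mulf_neq0 // gt_eqF.
Qed.

(** * Planks and homothetic copies of a symmetric body *)

(** The coefficients of [z] on the [k j] come from [plank_matrix], applied to the
values of the functionals at the [k j], each functional divided by its maximum. *)
Lemma plank_symmetric (R : realType) (V : lmodType R) (K : set V) (n : nat)
    (phi : 'I_n -> {scalar V}) (k : 'I_n -> V) (m : 'I_n -> R) :
  (0 < n)%N -> symmetric_convex K -> (forall i, support_point K (phi i) (k i)) ->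
  exists z, K z /\ forall i, n%:R^-1 * phi i (k i) <= `|phi i z - m i|.
Proof.
move=> n_gt0 Ks kS.
have M_gt0 i : 0 < phi i (k i) by have [] := kS i.
pose A : 'M[R]_n := \matrix_(i, j) (phi i (k j) / phi i (k i)).
have A1 i : A i i = 1 by rewrite mxE mulfV // gt_eqF.
have [l [l1 lP]] := plank_matrix (fun i => m i / phi i (k i)) n_gt0 A1.
exists (\sum_j l j *: k j); split=> [|i].
  have Kk j : K (k j) by have [] := kS j.
  exact: (symmetric_convex_sum Ks (Kk (Ordinal n_gt0))).
rewrite -ler_pdivlMr // -[X in _ / X]gtr0_norm // -normf_div.
apply: le_trans (lP i) _; rewrite mulrBl linear_sum mulr_suml.
rewrite le_eqVlt; apply/orP; left; apply/eqP; congr (`| _ - _ |).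
by apply: eq_bigr => j _; rewrite linearZ mxE /= mulrC mulrA.
Qed.

Lemma scaled_translate_strip (R : realType) (d : nat) (C : set 'rV[R]_d)
    (c k x p : 'rV[R]_d) (l : R) (phi : {scalar 'rV[R]_d}) :
  support_point [set k | C (c + k)] phi k -> 0 <= l ->
  scaled_translate x l C p -> `|phi p - phi (x + l *: c)| <= l * phi k.
Proof.
move=> [_ _ kmax] l_ge0 [y Cy <-].
rewrite -linearB opprD addrACA subrr add0r -scalerBr linearZ normrM ger0_norm //.
by rewrite ler_wpM2l // kmax //= addrC subrK.
Qed.

(** [scaled_translate_strip] is strict at an interior point, since one can still
move a little along [k] and along [- k]. *)
Lemma interior_strip (R : realType) (d : nat) (C : set 'rV[R]_d)
    (c k x p : 'rV[R]_d) (l : R) (phi : {scalar 'rV[R]_d}) :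
  support_point [set k | C (c + k)] phi k -> 0 <= l ->
  (scaled_translate x l C)° p -> `|phi p - phi (x + l *: c)| < l * phi k.
Proof.
move=> kS l_ge0 /interior_normP[e e_gt0 pS]; have [_ phik _] := kS.
have [s s_gt0 sk] := exists_small_scale k e_gt0.
have := scaled_translate_strip kS l_ge0 (pS _ sk).
have := scaled_translate_strip kS l_ge0 (pS (- (s *: k)) _).
rewrite normrN => /(_ sk); set q := x + l *: c.
rewrite linearB (linearD _ p (s *: k)) linearZ /= !ler_norml ltr_norml.
have sphi : 0 < s * phi k by rewrite mulr_gt0.
move=> /andP[h1 h2] /andP[h3 h4]; apply/andP; split; lra.
Qed.

(** The points [q + l a k] with [|a| < 1], where [q] is the centre, are interior, and
[phi] takes on them all values at distance less than [l * phi k] from [phi q]. *)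
Lemma interior_reaches (R : realType) (d : nat) (C : set 'rV[R]_d)
    (c k x : 'rV[R]_d) (l v : R) (phi : {scalar 'rV[R]_d}) :
  symmetric_convex [set k | C (c + k)] -> C° !=set0 ->
  support_point [set k | C (c + k)] phi k -> 0 < l ->
  `|v - phi (x + l *: c)| < l * phi k ->
  exists2 p, (scaled_translate x l C)° p & phi p = v.
Proof.
move=> Ks Cint [Kk phik _] l_gt0; set q := x + l *: c => v_lt.
have [e e_gt0 cC] := recentered_ball Ks Cint.
have lphi_gt0 : 0 < l * phi k by rewrite mulr_gt0.
pose a := (v - phi q) / (l * phi k).
have a_lt1 : `|a| < 1.
  by rewrite normf_div [X in _ / X]gtr0_norm // ltr_pdivrMr // mul1r.
exists (q + l *: (a *: k)); last first.
  rewrite linearD !linearZ /= /a.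
  by field; rewrite !gt_eqF.
apply/interior_normP; set r := l * (1 - `|a|).
have r_gt0 : 0 < r by rewrite mulr_gt0 // subr_gt0.
exists (r * e) => [|u ue]; first by rewrite mulr_gt0.
pose w := r^-1 *: u.
have Kw : C (c + w).
  apply: cC; rewrite normrZ normfV (gtr0_norm r_gt0) mulrC.
  by rewrite ltr_pdivrMr // mulrC.
have Ksg : C (c + Num.sg a *: k).
  apply: (symmetric_convexZ Ks Kk); rewrite normr_sg.
  by case: (_ == _); rewrite ?ler01.
(* the neighbour of q + l a k is a convex combination of +- k and of a small w *)
have := Ks.2 _ _ `|a| (normr_ge0 a) (ltW a_lt1) Ksg Kw => /= Caw.
exists (c + (`|a| *: (Num.sg a *: k) + (1 - `|a|) *: w)) => //.
have -> : `|a| *: (Num.sg a *: k) = a *: k by rewrite scalerA mulrC -numEsg.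
have lw : l *: ((1 - `|a|) *: w) = u.
  by rewrite !scalerA mulfV ?scale1r // gt_eqF.
by rewrite !scalerDr lw /q !addrA.
Qed.

(** The levels [2 (i+1) / (n+1) - 1] cut [[-1, 1]] into [n+1] intervals of
length [2 / (n+1) < 2 l], and an interval of radius [l] inside [[-1, 1]] has to
contain one of them. *)
Lemma grid_hit (R : realType) (n : nat) (u l : R) :
  (n.+1%:R)^-1 < l -> `|u| <= 1 - l ->
  exists i : 'I_n, `|(2 * i.+1%:R / n.+1%:R - 1) - u| < l.
Proof.
move=> l_gt u_le; set N : R := n.+1%:R in l_gt *.
have N_gt0 : 0 < N by rewrite ltr0n.
have Nl : 1 < l * N by rewrite -ltr_pdivrMr // mul1r.
move: u_le; rewrite ler_norml => /andP[u_ge u_le].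
(* the integer part of t is the integer nearest to (u + 1) N / 2 *)
pose t := ((u + 1) * N + 1) / 2.
have t_gt1 : 1 < t by rewrite /t; nra.
have t_lt : t < N by rewrite /t; nra.
have t_ge0 : 0 <= t by lra.
have /andP[kt tk] := truncn_itv t_ge0.
case E : (Num.truncn t) kt tk => [|k] kt tk; first by lra.
have kn : (k < n)%N.
  by have := le_lt_trans kt t_lt; rewrite ltr_nat ltnS.
exists (Ordinal kn) => /=.
have -> : 2 * k.+1%:R / N - 1 - u = (2 * k.+1%:R - N * (1 + u)) / N.
  by field; rewrite gt_eqF.
rewrite normf_div [X in _ / X]gtr0_norm // ltr_pdivrMr //.
apply: le_lt_trans Nl; rewrite ler_norml.
have k2 : k.+2%:R = k.+1%:R + 1 :> R by rewrite -addn1 natrD.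
by move: kt tk; rewrite k2 /t => kt tk; apply/andP; split; lra.
Qed.

(** Compare the extreme values of [phi] on the copy with those on [C]. *)
Lemma center_position (R : realType) (d : nat) (C : set 'rV[R]_d)
    (c k x : 'rV[R]_d) (l : R) (phi : {scalar 'rV[R]_d}) :
  symmetric_convex [set k | C (c + k)] ->
  support_point [set k | C (c + k)] phi k -> scaled_translate x l C `<=` C ->
  `|phi (x + l *: c) - phi c| <= (1 - l) * phi k.
Proof.
move=> Ks [Kk _ kmax] xC.
have step h : C (c + h) -> `|phi (x + l *: c) + l * phi h - phi c| <= phi k.
  move=> Kh; have := kmax (x + l *: (c + h) - c).
  rewrite /= [c + (_ - c)]addrC subrK scalerDr addrA linearB linearD linearZ /=.
  by apply; apply: xC; exists (c + h) => //; rewrite scalerDr addrA.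
have := step _ Kk; have := step _ (Ks.1 _ Kk); rewrite linearN !ler_norml.
by move=> /andP[h1 h2] /andP[h3 h4]; apply/andP; split; lra.
Qed.

(** The copy has centre [c + n/(n+1) z], and each of its points is the average of
a point of [C] with weight [1/(n+1)] and of [c + z] with weight [n/(n+1)]. *)
Lemma scaled_translate_subset (R : realType) (d n : nat) (C : set 'rV[R]_d)
    (c z : 'rV[R]_d) :
  symmetric_convex [set k | C (c + k)] -> C (c + z) ->
  scaled_translate (c + (n%:R / n.+1%:R) *: z - (n.+1%:R)^-1 *: c)
    (n.+1%:R)^-1 C `<=` C.
Proof.
move=> Ks Kz _ [y Cy <-]; set t := n.+1%:R^-1.
have N_gt0 : 0 < n.+1%:R :> R by rewrite ltr0n.
have tE : n%:R / n.+1%:R = 1 - t :> R.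
  by rewrite /t -natr1; field; rewrite natr1 gt_eqF.
have Ky : C (c + (y - c)) by rewrite addrC subrK.
have t0 : 0 <= t by rewrite invr_ge0 ltW.
have t1 : t <= 1 by rewrite invf_le1 // ler1n.
have := Ks.2 _ _ t t0 t1 Ky Kz; rewrite /= -tE.
rewrite (_ : c + (_ + _) = c + (n%:R / n.+1%:R) *: z - t *: c + t *: y) //.
rewrite scalerBr -!addrA; congr (_ + _).
by rewrite [RHS]addrC [- _ + t *: y]addrC -addrA.
Qed.

(** * The plank theorem and its sharpness *)

Set Strict Implicit.
Unset Implicit Arguments.

Theorem mainTheorem3 (R : realType) (d : nat) (hd : (1 <= d)%N) :
  (forall (C : set 'rV[R]_d) (n : nat) (H : 'I_n -> set 'rV[R]_d),
     convex_body C -> centrally_symmetric C ->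
     (forall i : 'I_n, hyperplane (H i)) ->
     exists x : 'rV[R]_d,
       scaled_translate x (n.+1%:R)^-1 C `<=` C /\
       (forall i : 'I_n,
          interior (scaled_translate x (n.+1%:R)^-1 C) `&` H i = set0))
  /\
  (forall (n : nat) (C : set 'rV[R]_d),
     (1 <= n)%N -> convex_body C -> centrally_symmetric C ->
     exists H : 'I_n -> set 'rV[R]_d,
       (forall i : 'I_n, hyperplane (H i)) /\
       (forall l : R, (n.+1%:R)^-1 < l ->
          ~ exists x : 'rV[R]_d,
              scaled_translate x l C `<=` C /\
              (forall i : 'I_n, interior (scaled_translate x l C) `&` H i = set0))).
Proof.
split=> [C n H [Ccp Cc Cint] [c Csym] Hhyp | n C n_gt0 [Ccp Cc Cint] [c Csym]];
  have Ks := recentered_symmetric_convex Cc Csym.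
- case: n H Hhyp => [|n] H Hhyp.
    exists 0; split=> [_ [y Cy <-]|[]//].
    by rewrite add0r invr1 scale1r.
  have [phi phiP] := choice Hhyp; have [m mP] := choice phiP.
  have [k kS] := choice (fun i =>
    support_point_exists Ccp Ks Cint (proj1 (mP i))).
  have N_gt0 : 0 < n.+1%:R :> R by rewrite ltr0n.
  have N1_gt0 : 0 < n.+2%:R :> R by rewrite ltr0n.
  have [z [Kz zP]] := plank_symmetric
    (fun i => (m i - phi i c) * (n.+2%:R / n.+1%:R)) (ltn0Sn n) Ks kS.
  eexists; split; first exact: scaled_translate_subset Ks Kz.
  move=> i; rewrite (proj2 (mP i)); apply/seteqP; split=> // p [pS /= pm].
  have t_ge0 : 0 <= n.+2%:R^-1 :> R by rewrite invr_ge0 ltW.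
  have := interior_strip (kS i) t_ge0 pS; rewrite ltNge => /negP; apply.
  rewrite pm subrK linearD linearZ /= distrC.
  rewrite (_ : _ - m i = n.+1%:R / n.+2%:R
      * (phi i z - (m i - phi i c) * (n.+2%:R / n.+1%:R))); last first.
    by field; rewrite !gt_eqF.
  rewrite normrM gtr0_norm ?divr_gt0 //.
  rewrite (_ : _^-1 * _ = n.+1%:R / n.+2%:R * (n.+1%:R^-1 * phi i (k i))).
    by rewrite ler_pM2l ?divr_gt0.
  by field; rewrite !gt_eqF.
- pose phi : {scalar 'rV[R]_d} :=
    mxtrace \o mulmxr (delta_mx (Ordinal hd) ord0 : 'cV[R]_d).
  have phi_neq0 : exists v, phi v != 0.
    exists (delta_mx ord0 (Ordinal hd)).
    by rewrite /phi /= mul_delta_mx trace_mx11 mxE !eqxx oner_neq0.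
  have [k kS] := support_point_exists Ccp Ks Cint phi_neq0.
  have [_ M_gt0 _] := kS; set M := phi k in M_gt0.
  pose level (i : 'I_n) : R := phi c + M * (2 * i.+1%:R / n.+1%:R - 1).
  exists (fun i => [set x | phi x = level i]); split=> [i|l l_gt [x [xC avoid]]].
    by exists phi, (level i).
  have l_gt0 : 0 < l by apply: lt_trans l_gt; rewrite invr_gt0 ltr0n.
  have := center_position Ks kS xC; set q := x + l *: c; rewrite -/M => q_near.
  have [|i hit] := grid_hit (u := (phi q - phi c) / M) l_gt.
    by rewrite normf_div [X in _ / X]gtr0_norm // ler_pdivrMr.
  have level_near : `|level i - phi q| < l * M.
    rewrite -ltr_pdivrMr // -[X in _ / X]gtr0_norm // -normf_div.
    rewrite (_ : _ / M = 2 * i.+1%:R / n.+1%:R - 1 - (phi q - phi c) / M) //.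
    by rewrite /level; field; rewrite !gt_eqF // ltr0n.
  have [p pS pE] := interior_reaches Ks Cint kS l_gt0 level_near.
  by have : set0 p; [rewrite -(avoid i) | ].
Qed.
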